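(* The categories $\mathbf{REL}^{\mathrm{op}}$ and $\mathbf{CABARel}$ are equivalent. An equivalence $\mathbf{REL}^{\mathrm{op}} \to \mathbf{CABARel}$ is given on objects by $X \mapsto \mathcal{P}(X)$, and sends a relation $R : X \to\!\!\!\!\!\mapsto Y$, regarded as a morphism $Y \to X$ of $\mathbf{REL}^{\mathrm{op}}$, to $\mathrm{Low}(R^\dagger) : \mathcal{P}(Y) \to\!\!\!\!\!\mapsto \mathcal{P}(X)$.
   Context: A relation $R : A \to\!\!\!\!\!\mapsto B$ is a subset $R \subseteq A \times B$; write $a \mathrel{R} b$ for $(a,b)\in R$. Composition is written in diagrammatic order: $a \mathrel{(R;S)} c$ iff there is $b$ with $a \mathrel{R} b$ and $b \mathrel{S} c$. The converse $R^\dagger : B \to\!\!\!\!\!\mapsto A$ is given by $b \mathrel{R^\dagger} a$ iff $a \mathrel{R} b$. $\mathbf{REL}$ is the category of sets and relations with this composition and identity relations. An atom of a poset with bottom $\bot$ is an element $a \neq \bot$ such that $x \sqsubseteq a$ implies $x=\bot$ or $x=a$. A CABA (complete atomic Boolean algebra) is a complete Boolean algebra in which every element is the join of the atoms below it. A relation $R : \mathcal{B} \to\!\!\!\!\!\mapsto \mathcal{B}'$ between CABAs is: a bimodule if $p' \sqsubseteq p \mathrel{R} q \sqsubseteq q'$ implies $p' \mathrel{R} q'$; left-disjunctive if, for any family $(a_i)_{i\in I}$, $a_i \mathrel{R} b$ for all $i\in I$ implies $(\bigsqcup_{i\in I} a_i) \mathrel{R} b$; atomic-founded if whenever $a$ is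 an atom of $\mathcal{B}$ and $a \mathrel{R} b$, there is an atom $b' \sqsubseteq b$ of $\mathcal{B}'$ with $a \mathrel{R} b'$; directionally atomic if it is all three. $\mathbf{CABARel}$ is the category whose objects are CABAs and whose morphisms are directionally atomic relations, with relational composition and with identity on $\mathcal{B}$ the order relation $\sqsubseteq_{\mathcal{B}}$. For a relation $R : X \to\!\!\!\!\!\mapsto Y$, the lower relation $\mathrm{Low}(R) : \mathcal{P}(X) \to\!\!\!\!\!\mapsto \mathcal{P}(Y)$ is defined by $S \mathrel{\mathrm{Low}(R)} T$ iff for all $s\in S$ there exists $t \in T$ with $s \mathrel{R} t$. *)

(* Defs.v *)
(* Relations are sets of pairs in MathComp's classical set theory, so that   *)
(* equality of morphisms is Leibniz equality (extensional by boolp). Boolean *)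
(* algebras are MathComp's ctbDistrLatticeType, which allows \bot = \top, as *)
(* needed for the powerset of an empty type.                                 *)
From HB Require Import structures.
From mathcomp Require Import all_boot all_order.
From mathcomp Require Import boolp classical_sets.

Set Implicit Arguments.
Unset Strict Implicit.
Unset Printing Implicit Defensive.

Import Order.TTheory.
Local Open Scope classical_set_scope.

(* [comp f g] is in diagrammatic order: first [f], then [g]. *)
Record category := Category {
  obj :> Type;
  hom : obj -> obj -> Type;
  idm : forall A, hom A A;
  comp : forall A B C, hom A B -> hom B C -> hom A C;
  comp_idl : forall A B (f : hom A B), comp (idm A) f = f;
  comp_idr : forall A B (f : hom A B), comp f (idm B) = f;
  comp_assoc : forall A B C D (f : hom A B) (g : hom B C) (h : hom C D),
    comp f (comp g h) = comp (comp f g) h }.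

Arguments idm {c} A.

Definition opposite (C : category) : category :=
  @Category C (fun A B => hom B A) (@idm C) (fun _ _ _ f g => comp g f)
    (fun _ _ f => comp_idr f) (fun _ _ f => comp_idl f)
    (fun _ _ _ _ f g h => esym (comp_assoc h g f)).

Definition is_functor (C D : category) (Fo : C -> D)
    (Fh : forall A B, hom A B -> hom (Fo A) (Fo B)) : Prop :=
  (forall A, Fh _ _ (idm A) = idm (Fo A)) /\
  (forall A B E (f : hom A B) (g : hom B E),
    Fh _ _ (comp f g) = comp (Fh _ _ f) (Fh _ _ g)).

Record functor (C D : category) := Functor {
  fobj :> C -> D;
  fhom : forall A B, hom A B -> hom (fobj A) (fobj B);
  functorP : is_functor fhom }.

Arguments Functor {C D fobj fhom} functorP.

Lemma id_is_functor (C : category) :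
  @is_functor C C id (fun _ _ f => f).
Proof. by []. Qed.

Definition id_functor (C : category) : functor C C :=
  Functor (id_is_functor C).

Lemma comp_is_functor (C D E : category) (F : functor C D) (G : functor D E) :
  @is_functor C E (fun A => G (F A)) (fun _ _ f => fhom G (fhom F f)).
Proof.
case: F G => [Fo Fh [Fid Fcomp]] [Go Gh [Gid Gcomp]] /=.
by split=> [A|A B K f g] /=; rewrite ?Fid ?Gid ?Fcomp ?Gcomp.
Qed.

Definition comp_functor (C D E : category) (F : functor C D)
  (G : functor D E) : functor C E := Functor (comp_is_functor F G).

Definition is_iso (C : category) (A B : C) (f : hom A B) : Prop :=
  exists g : hom B A, comp f g = idm A /\ comp g f = idm B.

Definition naturally_isomorphic (C D : category) (F G : functor C D) : Prop :=
  exists eta : forall A, hom (F A) (G A),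
    (forall A B (f : hom A B), comp (fhom F f) (eta B) = comp (eta A) (fhom G f))
    /\ (forall A, is_iso (eta A)).

Definition is_equivalence (C D : category) (F : functor C D) : Prop :=
  exists G : functor D C,
    naturally_isomorphic (id_functor C) (comp_functor F G) /\
    naturally_isomorphic (comp_functor G F) (id_functor D).

Definition equivalent (C D : category) : Prop :=
  exists F : functor C D, is_equivalence F.

Definition rel_id (X : Type) : set (X * X) := [set xy | xy.1 = xy.2].

(* The library's [S \; R] is in applicative order. *)
Definition rel_comp (X Y Z : Type) (R : set (X * Y)) (S : set (Y * Z)) :
  set (X * Z) := (S \; R)%relation.

Definition converse (X Y : Type) (R : set (X * Y)) : set (Y * X) :=
  (R^-1)%relation.

Lemma rel_comp_idl (X Y : Type) (R : set (X * Y)) :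
  rel_comp (@rel_id X) R = R.
Proof.
apply/seteqP; split=> [[x y] [z xz Rzy]|[x y] Rxy].
  by rewrite /rel_id /= in xz; rewrite xz.
by exists x.
Qed.

Lemma rel_comp_idr (X Y : Type) (R : set (X * Y)) :
  rel_comp R (@rel_id Y) = R.
Proof.
apply/seteqP; split=> [[x y] [z Rxz zy]|[x y] Rxy].
  by rewrite /rel_id /= in zy; rewrite -zy.
by exists y.
Qed.

Lemma rel_comp_assoc (X Y Z W : Type) (R : set (X * Y)) (S : set (Y * Z))
    (T : set (Z * W)) :
  rel_comp R (rel_comp S T) = rel_comp (rel_comp R S) T.
Proof.
apply/seteqP; split=> [[x w] [y /= Rxy [z /= Syz Tzw]]|].
  by exists z => //; exists y.
by move=> [x w] [z /= [y /= Rxy Syz] Tzw]; exists y => //; exists z.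
Qed.

Definition REL : category :=
  @Category Type (fun X Y => set (X * Y)) rel_id rel_comp
    rel_comp_idl rel_comp_idr rel_comp_assoc.

Definition atom (d : Order.disp_t) (B : ctbDistrLatticeType d) (a : B) : Prop :=
  a <> \bot%O /\ forall x : B, (x <= a)%O -> x = \bot%O \/ x = a.

Record CABA := MkCABA {
  caba_disp : Order.disp_t;
  caba_sort :> ctbDistrLatticeType caba_disp;
  caba_sup : forall A : set caba_sort, exists s, supremums A s;
  caba_inf : forall A : set caba_sort, exists i, infimums A i;
  caba_atomic : forall x : caba_sort,
    supremums [set a | atom a /\ (a <= x)%O] x }.

Section DirectionallyAtomic.
Context {B B' : CABA}.
Implicit Type R : set (B * B').

Definition bimodule R : Prop := forall (p' p : B) (q q' : B'),
  (p' <= p)%O -> R (p, q) -> (q <= q')%O -> R (p', q').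

Definition left_disjunctive R : Prop :=
  forall (I : Type) (a : I -> B) (b : B'), (forall i, R (a i, b)) ->
  forall s, supremums (range a) s -> R (s, b).

Definition atomic_founded R : Prop := forall (a : B) (b : B'),
  atom a -> R (a, b) -> exists b', [/\ atom b', (b' <= b)%O & R (a, b')].

Definition directionally_atomic R : Prop :=
  [/\ bimodule R, left_disjunctive R & atomic_founded R].

End DirectionallyAtomic.

Record da_relation (B B' : CABA) := DARelation {
  da_rel :> set (B * B');
  da_relP : directionally_atomic da_rel }.

Lemma da_relation_eq (B B' : CABA) (R S : da_relation B B') :
  da_rel R = da_rel S -> R = S.
Proof.
case: R S => [R RP] [S SP] /= RS; rewrite {}RS in RP *.
by congr DARelation; exact: Prop_irrelevance.
Qed.

Definition order_rel (B : CABA) : set (B * B) := [set xy | (xy.1 <= xy.2)%O].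

Lemma order_rel_da (B : CABA) : directionally_atomic (@order_rel B).
Proof.
split=> [p' p q q' /= p'p pq qq'|I a b ab s [_ /= s_le]|a b atom_a ab].
- exact: le_trans p'p (le_trans pq qq').
- by apply: s_le => _ [i _ <-]; exact: ab.
- by exists a; split => //; rewrite /order_rel /=.
Qed.

Lemma rel_comp_da (B B' B'' : CABA) (R : da_relation B B')
    (S : da_relation B' B'') : directionally_atomic (rel_comp R S).
Proof.
case: R S => [R [Rb Rd Ra]] [S [Sb Sd Sa]] /=.
split=> [p' p q q' p'p [z /= Rpz Szq] qq'|I a c ac s sP|a c atom_a].
- by exists z => /=; [exact: Rb p'p Rpz _|exact: Sb Szq qq'].
- have [t [t_ub t_lub]] := caba_sup [set z | S (z, c)].
  exists t => /=.
    apply: (Rd I a) sP => i; have [z /= Raz Szc] := ac i.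
    by apply: Rb (lexx _) Raz _; exact: t_ub.
  apply: (Sd {z | S (z, c)} sval) => [[z]//|].
  have -> : range (@sval _ (fun z => S (z, c))) = [set z | S (z, c)].
    apply/seteqP; split=> [_ [[z Sz] _ <-]//|z Sz].
    by exists (exist _ z Sz).
  by split.
- move=> [b /= Rab Sbc]; have [b' [atom_b' b'b Rab']] := Ra _ _ atom_a Rab.
  have [c' [atom_c' c'c Sb'c']] := Sa _ _ atom_b' (Sb _ _ _ _ b'b Sbc (lexx c)).
  by exists c'; split=> //; exists b'.
Qed.

Definition da_id (B : CABA) : da_relation B B := DARelation (order_rel_da B).

Definition da_comp (B B' B'' : CABA) (R : da_relation B B')
  (S : da_relation B' B'') : da_relation B B'' :=
  DARelation (rel_comp_da R S).

Lemma da_comp_idl (B B' : CABA) (R : da_relation B B') :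
  da_comp (da_id B) R = R.
Proof.
apply: da_relation_eq; case: R => [R [Rb _ _]] /=.
apply/seteqP; split=> [[x y] [z /= xz Rzy]|[x y] Rxy].
  exact: Rb xz Rzy (lexx y).
by exists x => //; rewrite /order_rel /=.
Qed.

Lemma da_comp_idr (B B' : CABA) (R : da_relation B B') :
  da_comp R (da_id B') = R.
Proof.
apply: da_relation_eq; case: R => [R [Rb _ _]] /=.
apply/seteqP; split=> [[x y] [z /= Rxz zy]|[x y] Rxy].
  exact: Rb (lexx x) Rxz zy.
by exists y => //; rewrite /order_rel /=.
Qed.

Lemma da_comp_assoc (A B C D : CABA) (R : da_relation A B)
    (S : da_relation B C) (T : da_relation C D) :
  da_comp R (da_comp S T) = da_comp (da_comp R S) T.
Proof. by apply: da_relation_eq; exact: rel_comp_assoc. Qed.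

Definition CABARel : category :=
  @Category CABA da_relation da_id da_comp
    da_comp_idl da_comp_idr da_comp_assoc.

Section Powerset.
Context (X : Type).

Lemma powerset_sup (A : set (set X)) : exists s, supremums A s.
Proof.
exists (\bigcup_(S in A) S); split=> [S AS|S S_ub]; rewrite subsetEset.
  exact: bigcup_sup.
by apply: bigcup_sub => T AT; rewrite -subsetEset; exact: S_ub.
Qed.

Lemma powerset_inf (A : set (set X)) : exists i, infimums A i.
Proof.
exists (\bigcap_(S in A) S); split=> [S AS|S S_lb]; rewrite subsetEset.
  exact: bigcap_inf.
by apply: sub_bigcap => T AT; rewrite -subsetEset; exact: S_lb.
Qed.

Lemma atom_set1 (x : X) : atom ([set x] : set X).
Proof.
split=> [|S]; first by apply/eqP/set0P; exists x.
by rewrite subsetEset => /subset_set1.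
Qed.

Lemma powerset_atomic (S : set X) :
  supremums [set a : set X | atom a /\ (a <= S)%O] S.
Proof.
split=> [a [_ //]|T T_ub]; rewrite subsetEset => x Sx.
have /T_ub : [set a : set X | atom a /\ (a <= S)%O] [set x].
  by split; [exact: atom_set1|rewrite subsetEset => _ ->].
by rewrite subsetEset; apply.
Qed.

Definition powerset_caba : CABA :=
  MkCABA powerset_sup powerset_inf powerset_atomic.

End Powerset.

Definition Low (X Y : Type) (R : set (X * Y)) :
    set (powerset_caba X * powerset_caba Y) :=
  [set ST : set X * set Y |
    forall s, ST.1 s -> exists t, ST.2 t /\ R (s, t)].

(* Main.v *)
(* The inverse equivalence sends a CABA to its type of atoms, and a           *)
(* directionally atomic relation [R] to the converse of its restriction to    *)
(* atoms. Atoms of a powerset are singletons, which gives the unit. The       *)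
(* counit at [B] relates a set [S] of atoms to every upper bound of [S]; its  *)
(* inverse relates [b] to every set containing all atoms below [b]. What      *)
(* makes this work is that in a Boolean algebra an atom below a supremum lies *)
(* below one of its members, so a set of atoms is recovered from its join.    *)
Require Import Defs.
From mathcomp Require Import all_boot all_order.
From mathcomp Require Import boolp classical_sets.

Set Implicit Arguments.
Unset Strict Implicit.
Unset Printing Implicit Defensive.

Import Order.Theory.
Local Open Scope classical_set_scope.

(** A directionally atomic [R] is determined by its restriction to atoms. Since every element is the
    join of its atoms, the bimodule law and left-disjunctivity make [x] related to [y] iff every
    atom below [x] is; atomic-foundedness and the bimodule law make an atom related to [y] iff it is
    related to some atom below [y]. Identifying elements with their sets of atoms, this says that
    [R] is [Low] of its restriction to atoms: [join_rel_iso] is the identification, resting on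
    [atom_le_supremum], and [Low_atoms_iso] is its naturality. *)

Section Atoms.
Context {B : CABA}.
Implicit Types (a b x s : B) (A : set B).

Lemma atom_le_eq a b : atom a -> atom b -> (a <= b)%O -> a = b.
Proof. by move=> [a0 _] [_ bP] /bP[]. Qed.

(** If [a] lies below no [x] in [A], each meet of [a] and [x] is properly below [a], hence bottom,
    so every [x], and with them [s], lies below the complement of [a]. Then [a] is below its own
    complement, contradicting [a] being an atom. *)
Lemma atom_le_supremum A a s :
  atom a -> supremums A s -> (a <= s)%O -> exists2 x, A x & (a <= x)%O.
Proof.
move=> [a0 aP] [_ s_lub] a_s; apply: contrapT => /forall2NP nle; apply: a0.
have s_compl : (s <= ~` a)%O.
  apply: s_lub => x Ax; rewrite -disj_leC meetC; apply/eqP.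
  have /aP[//|ax_a] := leIl a x; have [//|[]] := nle x.
  by rewrite leEmeet ax_a.
by apply/eqP; rewrite -lex0 -(meetxC a) lexI lexx (le_trans a_s).
Qed.

Lemma le_atomsP b c :
  (forall a, atom a -> (a <= b)%O -> (a <= c)%O) -> (b <= c)%O.
Proof.
by move=> bc; have [_] := caba_atomic b; apply=> a [atom_a /(bc _ atom_a)].
Qed.

End Atoms.

Lemma atom_powersetP (X : Type) (S : powerset_caba X) :
  atom S -> exists x, S = [set x].
Proof.
move=> [/eqP/set0P[x Sx] S_min]; exists x.
have /S_min[/seteqP[x0 _]|//] : ([set x] <= S :> set X)%O.
  by rewrite subsetEset => _ ->.
by have := x0 x erefl.
Qed.

Lemma powerset_supremumE (X : Type) (A : set (powerset_caba X))
    (S : powerset_caba X) :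
  supremums A S -> S = \bigcup_(T in A) T.
Proof.
have AP : supremums A (\bigcup_(T in A) T : powerset_caba X).
  split=> [T AT|T T_ub]; rewrite subsetEset; first exact: bigcup_sup.
  by apply: bigcup_sub => U AU; rewrite -subsetEset; exact: T_ub.
by move=> SP; exact: is_subset1_supremums SP AP.
Qed.

Lemma Low_directionally_atomic (X Y : Type) (R : set (X * Y)) :
  directionally_atomic (Low R).
Proof.
split.
- move=> S' S T T'; rewrite !subsetEset => S'S RST TT' s /S'S/RST[t [Tt Rst]].
  by exists t; split=> //; exact: TT'.
- move=> I S T RST U /powerset_supremumE -> s [_ [i _ <-] Sis].
  exact: RST Sis.
- move=> S T /atom_powersetP[x ->] /(_ x erefl)[t [Tt Rxt]].
  exists [set t]; split; first exact: atom_set1.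
    by rewrite subsetEset => _ ->.
  by move=> _ ->; exists t.
Qed.

Lemma Low_converse_functor :
  @is_functor (opposite REL) CABARel powerset_caba
    (fun (Y X : Type) (R : set (X * Y)) =>
       DARelation (Low_directionally_atomic (converse R))).
Proof.
split=> [X|X Y Z R S]; apply: da_relation_eq; apply/seteqP; split.
- move=> [S T] /= ST; rewrite /order_rel /= subsetEset => x /ST[y [Ty]].
  by rewrite /converse /rel_id /= => <-.
- by move=> [S T] /=; rewrite /order_rel /= subsetEset => ST x /ST Tx; exists x.
(* The interpolating set is the whole image of [W] under [S], the largest set that the second factor
   relates to [W]. *)
- move=> [U W] /= UW; exists [set y | exists2 z, W z & S (z, y)] => /= x.
    by move=> /UW[z [Wz [y /= Szy Ryx]]]; exists y; split=> //; exists z.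
  by move=> [z Wz Szx]; exists z.
- move=> [U W] [V /= UV VW] x /UV[y [/VW[z [Wz Szy]] Ryx]].
  by exists z; split=> //; exists y.
Qed.

Definition Low_functor : functor (opposite REL) CABARel :=
  Functor Low_converse_functor.

Definition atoms (B : CABA) : Type := {a : B | atom a}.

Lemma atoms_eq (B : CABA) (a b : atoms B) : sval a = sval b -> a = b.
Proof.
case: a b => [a aP] [b bP] /= ab; case: _ / ab in bP *.
by congr exist; exact: Prop_irrelevance.
Qed.

Definition atoms_rel (B B' : CABA) (R : da_relation B B') :
    set (atoms B' * atoms B) :=
  [set ba | da_rel R (sval ba.2, sval ba.1)].

(** Identities are preserved because comparable atoms are equal. For composites, atomic-foundedness
    of the first relation moves the middle element down to an atom, and the bimodule law keeps the
    second relation true there. *)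
Lemma atoms_rel_functor : @is_functor CABARel (opposite REL) atoms atoms_rel.
Proof.
split=> [B|B B' B'' R S]; apply/seteqP; split=> [[b a]|[b a]] /=.
- by move=> /atom_le_eq ab; apply/esym/atoms_eq/ab; exact: svalP.
- by rewrite /rel_id /= => ->; rewrite /atoms_rel /= /order_rel /=.
- have [_ _ R_founded] := da_relP R; have [Sb _ _] := da_relP S.
  move=> [c /= /R_founded[|c' [atom_c' c'c Rac'] Scb]]; first exact: svalP.
  by exists (exist _ c' atom_c') => //; exact: Sb c'c Scb (lexx _).
- by move=> [c Scb Rac]; exists (sval c).
Qed.

Definition atoms_functor : functor CABARel (opposite REL) :=
  Functor atoms_rel_functor.

Definition singleton_atom (X : Type) (x : X) : atoms (powerset_caba X) :=
  exist _ [set x] (atom_set1 x).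

Lemma singleton_atomP (X : Type) (a : atoms (powerset_caba X)) :
  exists x, a = singleton_atom x.
Proof.
by case: (a) (svalP a) => S aS _; have [x Sx] := atom_powersetP aS; exists x;
  exact: atoms_eq.
Qed.

Lemma atoms_Low_iso :
  naturally_isomorphic (id_functor (opposite REL))
    (comp_functor Low_functor atoms_functor).
Proof.
(* Membership pairs each singleton with its point; as atoms are exactly singletons, this is the
   graph of a bijection. *)
exists (fun X => [set ax : atoms (powerset_caba X) * X | sval ax.1 ax.2]).
split=> [X Y R|X].
  apply/seteqP; split=> [[b x] [y /= b_y Ryx]|[b x] [a /= a_b a_x]].
    by exists (singleton_atom x) => //= _ ->; exists y.
  by have [y [b_y Ryx]] := a_b x a_x; exists y.
exists [set xa : X * atoms (powerset_caba X) | sval xa.2 xa.1].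
split; apply/seteqP; split.
- move=> [x y] [a /=]; have [z ->] := singleton_atomP a.
  by rewrite /rel_id /= => -> ->.
- by move=> [x y] /=; rewrite /rel_id /= => ->; exists (singleton_atom y).
- move=> [a b] [x /=]; have [y ->] := singleton_atomP a.
  by have [z ->] := singleton_atomP b => /= -> ->.
- by move=> [a b] /=; rewrite /rel_id /= => ->; have [y ->] := singleton_atomP b;
    exists y.
Qed.

Section Counit.
Context (B : CABA).

Definition join_rel : set (powerset_caba (atoms B) * B) :=
  [set Sb | forall a : atoms B, Sb.1 a -> (sval a <= Sb.2)%O].

Definition atoms_below_rel : set (B * powerset_caba (atoms B)) :=
  [set bS | forall a : atoms B, (sval a <= bS.1)%O -> bS.2 a].

Lemma join_rel_da : directionally_atomic join_rel.
Proof.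
split.
- move=> S' S b b'; rewrite subsetEset => S'S Sb bb' a /S'S/Sb ab.
  exact: le_trans ab bb'.
- by move=> I S b Sb U /powerset_supremumE -> a [_ [i _ <-]]; exact: Sb.
- move=> S b /atom_powersetP[a ->] /(_ a erefl) ab.
  by exists (sval a); split=> //; [exact: svalP|move=> _ ->].
Qed.

Lemma atoms_below_rel_da : directionally_atomic atoms_below_rel.
Proof.
split.
- move=> b' b S S' b'b bS; rewrite subsetEset => SS' a ab'; apply: SS'.
  by apply: bS; exact: le_trans ab' b'b.
(* Left-disjunctivity is where the Boolean structure enters: an atom below the join is below some
   member of the family. *)
- move=> I b S bS s sP a /(atom_le_supremum (svalP a) sP)[_ [i _ <-]].
  exact: bS.
- move=> b S atom_b bS; exists [set exist _ b atom_b]; split.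
  + exact: atom_set1.
  + by rewrite subsetEset => _ ->; exact: bS.
  + by move=> a ab; apply/atoms_eq/atom_le_eq => //; exact: svalP.
Qed.

Lemma join_rel_iso :
  is_iso (DARelation join_rel_da : @hom CABARel (powerset_caba (atoms B)) B).
Proof.
exists (DARelation atoms_below_rel_da).
split; apply: da_relation_eq; apply/seteqP; split.
- move=> [S T] [b /= Sb bT]; rewrite /order_rel /= subsetEset => a /Sb.
  exact: bT.
- move=> [S T] /=; rewrite /order_rel /= subsetEset => ST.
  (* The middle element is the join of [S]: an atom below it is below some atom in [S], hence equal
     to it, so the join gains no new atoms. *)
  have [s sP] := caba_sup (sval @` S); exists s => a /= => [Sa|].
    by apply: sP.1; exists a.
  move=> /(atom_le_supremum (svalP a) sP)[_ [c Sc <-] ac]; apply: ST.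
  by rewrite (_ : a = c) //; apply/atoms_eq/atom_le_eq => //; exact: svalP.
- move=> [b c] [S /= bS Sc]; apply: le_atomsP => a atom_a ab.
  exact: (Sc (exist _ a atom_a)) (bS (exist _ a atom_a) ab).
- move=> [b c] bc; exists [set a | (sval a <= b)%O] => //= a ab.
  exact: le_trans ab bc.
Qed.

End Counit.

Lemma Low_atoms_iso :
  naturally_isomorphic (comp_functor atoms_functor Low_functor)
    (id_functor CABARel).
Proof.
exists (fun B => DARelation (join_rel_da B)).
split=> [B B' R|B]; last exact: join_rel_iso.
have [Rb Rd Ra] := da_relP R.
apply: da_relation_eq; apply/seteqP; split=> [[S b'] [T /= ST Tb']|].
  (* Each atom in [S] is related by [R] to an atom below [b'], hence to [b'] itself;
     left-disjunctivity passes this to the join of [S]. *)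
  have [s sP] := caba_sup (sval @` S); exists s => /= [a Sa|].
    by apply: sP.1; exists a.
  apply: (Rd {a | S a} (fun a => sval (sval a))) => [[a Sa]|] /=.
    by have [t [/Tb' tb' Rat]] := ST a Sa; exact: Rb (lexx _) Rat tb'.
  congr (supremums _ s): sP; apply/seteqP; split=> [_ [a Sa <-]|].
    by exists (exist _ a Sa).
  by move=> _ [[a Sa] _ <-]; exists a.
(* The converse takes all atoms below [b'] as middle set; atomic-foundedness of [R] supplies one for
   each atom in [S]. *)
move=> [S b'] [b /= Sb Rbb']; exists [set t | (sval t <= b')%O] => //= a Sa.
have [|t [atom_t tb' Rat]] := Ra _ _ (svalP a) (Rb _ _ _ _ _ Rbb' (lexx _)).
  exact: Sb.
by exists (exist _ t atom_t).
Qed.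

Lemma Low_equivalence : is_equivalence Low_functor.
Proof.
by exists atoms_functor; split; [exact: atoms_Low_iso|exact: Low_atoms_iso].
Qed.

Theorem mainTheorem1 :
  equivalent (opposite REL) CABARel /\
  exists (Low_da : forall (X Y : Type) (R : set (X * Y)),
            directionally_atomic (Low (converse R)))
         (LowP : @is_functor (opposite REL) CABARel powerset_caba
            (fun (Y X : Type) (R : set (X * Y)) => DARelation (Low_da X Y R))),
    is_equivalence (Functor LowP).
Proof.
split; first by exists Low_functor; exact: Low_equivalence.
exists (fun X Y R => Low_directionally_atomic (converse R)).
by exists Low_converse_functor; exact: Low_equivalence.
Qed.
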